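(* There exists an absolute constant $c_2>0$ such that for every irreducible, reversible (discrete-time) Markov chain on a finite state space $V$ with stationary distribution $\pi$, for all $\emptyset\neq B\subsetneq V$, $$\frac{c_2}{\lambda(B)}\;\le\;\max_{\emptyset\ne D\subseteq B}\mathbb{E}_{\pi_D}[T_{D^c}]\;\le\;\frac{1}{\lambda(B)}.$$ Hence, for all $\delta\in[\pi_*,1]$, $$\Lambda(\delta)\;\le\;\kappa(\delta)\;\le\;\frac{1}{c_2}\,\Lambda(\delta).$$
   Context: State spaces are assumed to have at least two elements. $(X_m)_{m\ge0}$ is the discrete-time chain with transition matrix $P$, $\pi(x)P(x,y)=\pi(y)P(y,x)$ for all $x,y$. For $D\subseteq V$, $T_{D}:=\inf\{m\ge0:X_m\in D\}$, $D^c:=V\setminus D$, and for nonempty $D$, $\pi_D(x):=\frac{\pi(x)}{\pi(D)}\mathbf 1\{x\in D\}$; $\mathbb{E}_\mu$ is expectation with initial distribution $\mu$. For $\emptyset\ne B\subsetneq V$, $P_B$ is the restriction of $P$ to $B$: $P_B(x,y)=P(x,y)$ for $x,y\in B$ (a substochastic $B\times B$ matrix). $\beta(B)=1-\lambda(B)$ denotes the largest eigenvalue of $P_B$. The set $B$ is called irreducible if $\sum_{n=0}^\infty (P_B)^n(x,y)>0$ for all $x,y\in B$. Let $\pi_*:=\min_{x\in V}\pi(x)$. The spectral profile $\Lambda:[\pi_*,\infty)\to(0,1]$ is defined by $\Lambda(\delta):=\min\{\lambda(B):B\subset V,\ 0<\pi(B)\le\delta\}$ for $\delta\in[\pi_*,1-\pi_*]$,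 and $\Lambda(\delta):=\Lambda(1-\pi_* )$ for $\delta>1-\pi_*$. The function $\kappa$ is defined by $$\kappa(\delta):=\min\left\{\frac{1}{\mathbb{E}_{\pi_B}[T_{B^c}]}: B\subset V,\ 0<\pi(B)\le \min\{\delta,1-\pi_*\},\ B\text{ is irreducible}\right\}.$$ *)

(* Defs.v *)
From HB Require Import structures.
From mathcomp Require Import all_boot all_order all_algebra.
From mathcomp Require Import all_classical all_reals all_analysis.

Set Implicit Arguments.
Unset Strict Implicit.
Unset Printing Implicit Defensive.

Import Order.TTheory GRing.Theory Num.Theory.

Local Open Scope ring_scope.

Section Chain.
Context {R : realType} {V : finType}.
Implicit Types (P : V -> V -> R) (pi mu : V -> R) (B D : {set V}).

Definition is_distribution mu : Prop :=
  (forall x, 0 <= mu x) /\ \sum_x mu x = 1.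

Definition is_stochastic P : Prop := forall x, is_distribution (P x).

(* Summing over x shows that such a distribution pi is stationary. *)
Definition is_reversible P pi : Prop :=
  forall x y, pi x * P x y = pi y * P y x.

(* P_B, with the elements of B numbered by enum_val. *)
Definition restr P B : 'M[R]_#|B| :=
  \matrix_(i, j) P (enum_val i) (enum_val j).

(* The chain itself is irreducible when B is the whole of V. *)
Definition is_irreducible P B : Prop :=
  forall i j : 'I_#|B|,
    (0 < \sum_(0 <= n <oo) ((restr P B ^+ n) i j)%:E)%E.

Definition weight pi B : R := \sum_(x in B) pi x.

Definition cond_distr pi D : V -> R :=
  fun x => pi x / weight pi D * (x \in D)%:R.

(* When P is reversible with respect to a positive distribution and B is not
   empty, P_B is similar to a real symmetric matrix: this set of real
   eigenvalues is the whole spectrum, it is finite and nonempty, and sup is its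
   maximum. *)
Definition beta P B : R := sup [set a | eigenvalue (restr P B) a]%classic.

Definition lambda P B : R := 1 - beta P B.

(* The neutral element 1 does not affect the minimum, as pi x <= 1. *)
Definition pi_min pi : R := \big[Num.min/1]_x pi x.

(* For pi_min pi <= delta the minimum is over a nonempty family, since it
   contains a singleton. All B in the family are proper subsets, by
   weight pi B <= 1 - pi_min pi. *)
Definition spectral_profile P pi (delta : R) : \bar R :=
  \big[mine/+oo%E]_(B : {set V} |
      0 < weight pi B <= Num.min delta (1 - pi_min pi))
    (lambda P B)%:E.

Section Process.
Context {d : measure_display} {Omega : measurableType d}.
Implicit Types (X : nat -> Omega -> V) (Pr : (V -> R) -> probability Omega R).

Definition history X (n : nat) (x : nat -> V) : set Omega :=
  [set w | forall i, (i <= n)%N -> X i w = x i]%classic.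

(* The last clause is the Markov property
   Q(X_(n+1) = x_(n+1) | X_0 = x_0, ..., X_n = x_n) = P(x_n, x_(n+1)),
   multiplied by the probability of the conditioning event. *)
Definition is_markov_chain P mu (Q : probability Omega R) X : Prop :=
  [/\ forall n x, measurable (X n @^-1` [set x])%classic,
      forall x, Q (X 0%N @^-1` [set x])%classic = (mu x)%:E
    & forall n x, Q (history X n.+1 x) =
                  (Q (history X n x) * (P (x n) (x n.+1))%:E)%E].

(* One process X, with a law Pr mu for each initial distribution mu. *)
Definition is_markov_family P Pr X : Prop :=
  forall mu, is_distribution mu -> is_markov_chain P mu (Pr mu) X.

(* Equal to +oo if the process never visits D. *)
Definition hitting_time X D (w : Omega) : \bar R :=
  ereal_inf [set (m%:R)%:E | m in [set m | X m w \in D]]%classic.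

Definition mean_exit_time Pr X pi D : \bar R :=
  (\int[Pr (cond_distr pi D)]_w hitting_time X (~: D) w)%E.

Definition kappa P Pr X pi (delta : R) : \bar R :=
  \big[mine/+oo%E]_(B : {set V} |
      (0 < weight pi B <= Num.min delta (1 - pi_min pi)) &&
      `[< is_irreducible P B >])
    (mean_exit_time Pr X pi B)^-1%E.

End Process.
End Chain.

(* Main.v *)
(* Write E for the Dirichlet form of the chain and u_D(x) for the mean exit time
   of D from x; (I - P) u_D = 1 on D, so E(g, u_D) = <g, 1> for every g supported
   in D. The upper bound follows from lambda <u_D, u_D> <= E(u_D, u_D) and
   Cauchy-Schwarz. For the lower bound, take an eigenfunction f >= 0 of P_B and
   cut it at the dyadic heights t 2^k: the layers carry disjoint parts of E(f, f),
   and the layer supported in D = {f > t 2^k} satisfies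
   <g, 1>^2 <= E(g, g) <u_D, 1> <= K pi(D) E(g, g), with K the maximal mean exit
   time over subsets of B. Summing over k gives <f, f> <= 48 K E(f, f), hence
   1 <= 48 K lambda(B). The statement on kappa follows because a reducible set
   splits into two parts without transitions between them, one of which has at
   least the same mean exit time. *)
Require Import Defs.
From mathcomp Require Import all_boot all_order all_algebra.
From mathcomp Require Import all_classical all_reals all_analysis measurable_realfun.
From mathcomp Require Import ring lra.

Import Order.TTheory GRing.Theory Num.Theory.
Import numFieldNormedType.Exports.
Local Open Scope ring_scope.

(** * Dirichlet form of a reversible chain *)

Definition inner_prod {R : realType} {V : finType} (pi f g : V -> R) : R :=
  \sum_x pi x * f x * g x.

Definition dirichlet_form {R : realType} {V : finType} (P : V -> V -> R)
    (pi f g : V -> R) : R :=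
  2^-1 * \sum_x \sum_y pi x * P x y * ((f x - f y) * (g x - g y)).

Definition supported {R : realType} {V : finType} (B : {set V}) (f : V -> R) :=
  forall x, x \notin B -> f x = 0.

Section Dirichlet.
Context {R : realType} {V : finType} (P : V -> V -> R) (pi : V -> R).
Hypothesis P_stoch : is_stochastic P.
Hypothesis P_rev : is_reversible P pi.
Implicit Types (f g u : V -> R) (B D : {set V}).

Local Notation ip := (inner_prod pi).
Local Notation E := (dirichlet_form P pi).

(** Discrete integration by parts: by reversibility, swapping [x] and [y] shows that the half of the
    double sum carrying [f y] is minus the half carrying [f x]. Rows of [P] sum to 1, which turns
    what remains into [(I - P) g]. *)
Lemma dirichlet_green f g :
  E f g = \sum_x pi x * f x * (g x - \sum_y P x y * g y).
Proof.
pose S := \sum_x \sum_y pi x * P x y * (f x * (g x - g y)).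
have SN : \sum_x \sum_y pi x * P x y * (f y * (g x - g y)) = - S.
  rewrite exchange_big /= -sumrN; apply: eq_bigr => x _.
  rewrite -sumrN; apply: eq_bigr => y _.
  by rewrite -P_rev -mulrN -[in RHS]mulrN opprB.
have -> : E f g = S.
  rewrite /dirichlet_form.
  have -> : \sum_x \sum_y pi x * P x y * ((f x - f y) * (g x - g y)) = S - - S.
    rewrite -SN /S -sumrB; apply: eq_bigr => x _.
    by rewrite -sumrB; apply: eq_bigr => y _; ring.
  by field.
apply: eq_bigr => x _.
have -> : g x = \sum_y P x y * g x by rewrite -mulr_suml (P_stoch x).2 mul1r.
rewrite -sumrB mulr_sumr; apply: eq_bigr => y _.
by rewrite -mulr_suml (P_stoch x).2; ring.
Qed.

Lemma dirichletC f g : E f g = E g f.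
Proof.
congr (_ * _); apply: eq_bigr => x _; apply: eq_bigr => y _.
by congr (_ * _); rewrite mulrC.
Qed.

Lemma dirichlet_subZ s f g :
  E (fun x => f x - s * g x) (fun x => f x - s * g x) =
  E f f - 2 * s * E f g + s ^+ 2 * E g g.
Proof.
rewrite /dirichlet_form !mulr_sumr -sumrB -big_split; apply: eq_bigr => x _ /=.
rewrite !mulr_sumr -sumrB -big_split; apply: eq_bigr => y _ /=.
by field.
Qed.

Lemma inner_subZ s f g :
  ip (fun x => f x - s * g x) (fun x => f x - s * g x) =
  ip f f - 2 * s * ip f g + s ^+ 2 * ip g g.
Proof.
rewrite /inner_prod !mulr_sumr -sumrB -big_split; apply: eq_bigr => x _ /=.
by ring.
Qed.

Hypothesis pi_gt0 : forall x, 0 < pi x.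

Lemma flow_ge0 x y : 0 <= pi x * P x y.
Proof. by rewrite mulr_ge0 ?(P_stoch x).1 ?ltW. Qed.

Lemma dirichlet_ge0 f : 0 <= E f f.
Proof.
rewrite mulr_ge0 ?invr_ge0//; apply: sumr_ge0 => x _; apply: sumr_ge0 => y _.
by rewrite mulr_ge0 ?flow_ge0// -expr2 sqr_ge0.
Qed.

(** Two functions appear on the left so that the pieces of a cut can share the energy of a single
    [f]. *)
Lemma dirichlet_le f g h :
  (forall x y, (g x - g y) ^+ 2 + (h x - h y) ^+ 2 <= (f x - f y) ^+ 2) ->
  E g g + E h h <= E f f.
Proof.
move=> H; rewrite -mulrDr ler_pM2l ?invr_gt0// -big_split; apply: ler_sum => x _.
rewrite -big_split; apply: ler_sum => y _ /=.
by rewrite -mulrDr ler_wpM2l ?flow_ge0// -!expr2.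
Qed.

Lemma dirichlet_contract f g :
  (forall x y, `|g x - g y| <= `|f x - f y|) -> E g g <= E f f.
Proof.
move=> H; have E0 : E (fun=> 0) (fun=> 0) = 0.
  by rewrite /dirichlet_form big1 ?mulr0// => x _; rewrite big1// => y _; rewrite subrr !mulr0.
rewrite -[leLHS]addr0 -E0; apply: dirichlet_le => x y.
by rewrite subrr expr0n addr0 -(real_normK (num_real (g x - g y)))
  -(real_normK (num_real (f x - f y))) lerXn2r// nnegrE.
Qed.

Lemma inner_gt0 f x : f x != 0 -> 0 < ip f f.
Proof.
move=> fx; rewrite /inner_prod (bigD1 x)//= ltr_pwDl//.
  by rewrite -mulrA mulr_gt0// -expr2 exprn_even_gt0.
by apply: sumr_ge0 => y _; rewrite -mulrA mulr_ge0 -?expr2 ?sqr_ge0 ?ltW.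
Qed.

(** * Dyadic level sets *)

Definition excess t (a : R) := Num.max (a - t) 0.
(** The slice of [a] between the heights [t] and [2 * t]. *)
Definition layer t (a : R) := Num.min (excess t a) t.

(** The excess over [t] is the layer plus the excess over [2 * t]. Both summands are nondecreasing
    in [a], so their increments have the same sign and the cross term in the square is
    nonnegative. *)
Lemma layer_excess t (a b : R) : 0 < t ->
  (layer t a - layer t b) ^+ 2 + (excess (2 * t) a - excess (2 * t) b) ^+ 2
  <= (excess t a - excess t b) ^+ 2.
Proof.
move=> t0.
have split_excess c : excess t c = layer t c + excess (2 * t) c.
  rewrite /layer /excess; case: (lerP (c - t) 0) => h1;
    case: (lerP (c - 2 * t) 0) => h2; case: lerP => h3; lra.
have mono c c' : c <= c' -> layer t c <= layer t c' /\ excess (2 * t) c <= excess (2 * t) c'.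
  move=> cc'; rewrite /layer /excess; split.
    by rewrite le_min2// le_max2// lerD2r.
  by rewrite le_max2// lerD2r.
rewrite !split_excess.
have [ab|/ltW ba] := leP a b; [have [h1 h2] := mono _ _ ab | have [h1 h2] := mono _ _ ba]; nra.
Qed.

(* Level-set argument: the layers of f at heights t, 2t, 4t, ... carry disjoint
   parts of the Dirichlet energy, and each layer is compared with the measures of
   its top and bottom through a^2 / b >= (8 a - b) / 16. *)
Lemma level_sets B K f :
  0 < K -> supported B f ->
  (forall D g s, D \subset B -> supported D g ->
     2 * s * (\sum_x pi x * g x) <= E g g + s ^+ 2 * (K * weight pi D)) ->
  forall M t, 0 < t -> (forall x, f x <= 2 ^+ M * t) ->
  \sum_x pi x * (if t < f x then (f x ^+ 2 - 7 * t ^+ 2) / 3 else 0) <=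
  16 * K * E (excess t \o f) (excess t \o f).
Proof.
move=> K0 fB HK; elim=> [|M IH] t t0 fM.
  (* Base case: [f <= t], so every term on the left is 0. *)
  rewrite big1 => [|x _]; first by apply: mulr_ge0 (dirichlet_ge0 _); lra.
  by rewrite ltNge; have := fM x; rewrite expr0 mul1r => ->; rewrite mulr0.
have {}IH := IH (2 * t).
have /IH {}IH : 0 < 2 * t by lra.
have {}IH := IH _; have {}IH := IH ltac:(by move=> x; rewrite mulrA -exprSr).
pose D : {set V} := finset (fun x => t < f x).
have DB : D \subset B.
  apply/fintype.subsetP => x; rewrite inE; apply: contraTT => /fB ->.
  by rewrite -leNgt ltW.
have gD : supported D (layer t \o f).
  move=> x; rewrite inE -leNgt /= /layer /excess => fx.
  by rewrite max_r ?subr_le0// min_l// ltW.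
(* With [s = t / (4 * K)], multiplying by [16 * K] removes [K] from all terms but the energy:
   [8 t S - t^2 w <= 16 K E2], linear in the mass [S] of the layer and the weight [w] of [D]. *)
have := HK D (layer t \o f) (t / (4 * K)) DB gD.
have := @dirichlet_le (excess t \o f) (layer t \o f) (excess (2 * t) \o f)
  (fun x y => layer_excess t _ _ t0).
set E1 := E _ _ in IH *; set E2 := E _ _; set E3 := E _ _ => H1 H2.
have H3 : 8 * t * (\sum_x pi x * (layer t \o f) x) - t ^+ 2 * weight pi D <= 16 * K * E2.
  set S := \sum_x _ in H2 *; set w := weight _ _ in H2 *.
  have e1 : 16 * K * (2 * (t / (4 * K)) * S) = 8 * t * S by field; lra.
  have e2 : 16 * K * ((t / (4 * K)) ^+ 2 * (K * w)) = t ^+ 2 * w by field; lra.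
  have : 16 * K * (2 * (t / (4 * K)) * S) <= 16 * K * (E2 + (t / (4 * K)) ^+ 2 * (K * w)).
    by rewrite ler_pM2l//; lra.
  rewrite mulrDr e1 e2; lra.
have H4 : 16 * K * (E2 + E1) <= 16 * K * E3 by rewrite ler_pM2l//; lra.
apply: le_trans H4; rewrite mulrDr; apply: le_trans (lerD H3 IH).
have -> : weight pi D = \sum_x pi x * (if t < f x then 1 else 0).
  by rewrite /weight big_mkcond; apply: eq_bigr => x _; rewrite inE; case: ifP; rewrite ?mulr1 ?mulr0.
rewrite !mulr_sumr -sumrB -big_split; apply: ler_sum => x _ /=.
rewrite /layer /excess.
have := pi_gt0 x; move: (pi x) (f x) => p a p0.
(* The inequality is now pointwise. For [a > 2 * t] it is an equality, since [-7/3 = 8 - 1 - 28/3];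
   this balance determines the constants 7 and 3. *)
suff : (if t < a then (a ^+ 2 - 7 * t ^+ 2) / 3 else 0) <=
  8 * t * (Num.min (Num.max (a - t) 0) t) - t ^+ 2 * (if t < a then 1 else 0) +
  (if 2 * t < a then (a ^+ 2 - 7 * (2 * t) ^+ 2) / 3 else 0).
  move=> /(ler_wpM2l (ltW p0)) /le_trans; apply; rewrite le_eqVlt; apply/orP; left.
  by apply/eqP; do 2!case: ifP => _; ring.
case: (ltrP t a) => h1; case: (ltrP (2 * t) a) => h2; try lra.
- by rewrite max_l ?min_r; lra.
- rewrite max_l ?min_l; try lra.
  have : 0 <= t * (a - t) by rewrite mulr_ge0; lra.
  have : 0 <= (2 * t - a) * (2 * t + a) by rewrite mulr_ge0; lra.
  lra.
- by rewrite max_r ?min_l; lra.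
Qed.

(** Letting [t] tend to 0 in [level_sets] removes the term [7 * t ^+ 2], and the division by 3 there
    turns 16 into 48. *)
Lemma level_sets_energy B K f :
  0 < K -> \sum_x pi x = 1 -> (forall x, 0 <= f x) -> supported B f ->
  (forall D g s, D \subset B -> supported D g ->
     2 * s * (\sum_x pi x * g x) <= E g g + s ^+ 2 * (K * weight pi D)) ->
  ip f f <= 48 * K * E f f.
Proof.
move=> K0 pi1 f0 fB HK; apply/ler_addgt0Pr => e e0.
(* As [t <= 1], also [7 * t ^+ 2 <= 7 * t <= e]. *)
pose t := Num.min 1 (e / 7).
have t0 : 0 < t by rewrite /t lt_min; apply/andP; split; lra.
have te : 7 * t ^+ 2 <= e.
  have t1 : t <= 1 by rewrite /t ge_min lexx.
  have te : t <= e / 7 by rewrite /t ge_min lexx orbT.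
  nra.
have [M fM] : exists M : nat, forall x, f x <= 2 ^+ M * t.
  pose F := \sum_x f x / t.
  exists (Num.truncn F).+1 => x; rewrite -ler_pdivrMr//.
  apply: (@le_trans _ _ F); first by rewrite /F (bigD1 x)//= lerDl sumr_ge0// => y _; rewrite divr_ge0// ltW.
  have F0 : 0 <= F by rewrite sumr_ge0// => y _; rewrite divr_ge0// ltW.
  apply: ltW; apply: lt_le_trans (truncnS_gt F) _.
  by rewrite -natrX ler_nat ltnW// ltn_expl.
have := level_sets _ _ _ K0 fB HK _ _ t0 fM.
have : E (excess t \o f) (excess t \o f) <= E f f.
  apply: dirichlet_contract => x y /=; rewrite /excess.
  rewrite ler_norml; have := ler_norm (f x - f y); have := ler_norm (f y - f x); rewrite distrC => h1 h2.
  by apply/andP; case: (lerP (f x - t) 0); case: (lerP (f y - t) 0); split; lra.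
(* Where [f <= t] the quantity [f ^+ 2 - 7 * t ^+ 2] is negative, so replacing it by 0 only
   increases the sum. *)
have : (ip f f - 7 * t ^+ 2) / 3 <= \sum_x pi x * (if t < f x then (f x ^+ 2 - 7 * t ^+ 2) / 3 else 0).
  have -> : (ip f f - 7 * t ^+ 2) / 3 = \sum_x pi x * ((f x ^+ 2 - 7 * t ^+ 2) / 3).
    transitivity ((ip f f - (\sum_x pi x) * (7 * t ^+ 2)) / 3); first by rewrite pi1 mul1r.
    rewrite /inner_prod mulr_suml -sumrB mulr_suml; by apply: eq_bigr => x _; field.
  apply: ler_sum => x _; rewrite ler_pM2l//.
  have := f0 x; move: (f x) => a a0; case: ltP => // h; nra.
move=> h1 h2 h3.
have : 16 * K * E (excess t \o f) (excess t \o f) <= 16 * K * E f f by rewrite ler_pM2l//; lra.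
lra.
Qed.
End Dirichlet.

(** * Variational characterisation of [lambda] *)

Section Spectral.
Context {R : realType} {V : finType} (P : V -> V -> R) (pi : V -> R).
Hypothesis P_stoch : is_stochastic P.
Hypothesis P_rev : is_reversible P pi.
Hypothesis pi_gt0 : forall x, 0 < pi x.
Implicit Types (f g u : V -> R) (B D : {set V}).

Local Notation ip := (inner_prod pi).
Local Notation E := (dirichlet_form P pi).

Lemma continuous_coord_sum (F : V -> 'rV[R]_#|V| -> R) :
  (forall x, continuous (F x)) -> continuous (fun v => \sum_x F x v).
Proof.
move=> Fc; apply: continuous_big => [|x _]; last exact: Fc.
exact: add_continuous.
Qed.

(** The Rayleigh quotient attains its minimum: the unit sphere of functions supported in [B] is
    compact and the energy is continuous. Functions are coded as row vectors to use the compactness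
    of boxes there. *)
Lemma dirichlet_minimizer B : B != finset.set0 -> exists f,
  [/\ supported B f, 0 < ip f f &
      forall g, supported B g -> E f f * ip g g <= E g g * ip f f].
Proof.
move=> /finset.set0Pn[b bB].
pose F (v : 'rV[R]_#|V|) x := v ord0 (enum_rank x).
have Fc x : continuous (fun v => F v x) by exact: coord_continuous.
have cM (f g : 'rV[R]_#|V| -> R) :
    continuous f -> continuous g -> continuous (fun v => f v * g v).
  by move=> fc gc v; exact: continuousM (fc v) (gc v).
have cB (f g : 'rV[R]_#|V| -> R) :
    continuous f -> continuous g -> continuous (fun v => f v - g v).
  by move=> fc gc v; exact: continuousB (fc v) (gc v).
have cC (a : R) : continuous (fun _ : 'rV[R]_#|V| => a) by exact: cst_continuous.
have Ic : continuous (fun v => ip (F v) (F v)).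
  by apply: continuous_coord_sum => x; apply: (cM _ _ _ (Fc x)); apply: (cM _ _ (cC _) (Fc x)).
have Ec : continuous (fun v => E (F v) (F v)).
  apply: (cM _ _ (cC _)); apply: continuous_coord_sum => x; apply: continuous_coord_sum => y.
  apply: (cM _ _ (cC _)).
  by apply: cM; exact: cB (Fc x) (Fc y).
(* If [ip g g = 1] then [g x ^+ 2 <= 1 / pi x], hence [g x] is at most [1 + 1 / pi x] in absolute
   value. The value 0 off [B] makes the box encode the support condition. *)
pose c x : R := if x \in B then 1 + (pi x)^-1 else 0.
pose box := [set v : 'rV[R]_#|V| | forall i,
  `[- c (enum_val i), c (enum_val i)]%classic (v ord0 i)]%classic.
have box_compact : compact box.
  apply: (@rV_compact R _ (fun i => `[- c (enum_val i), c (enum_val i)]%classic)) => i.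
  exact: segment_compact.
pose A := (box `&` [set v | ip (F v) (F v) = 1])%classic.
have A_compact : compact A.
  apply: compact_closedI => //.
  apply: (@preimage_closed _ _ (fun v => ip (F v) (F v)) [set x | x = 1]%classic).
    by move=> v _; exact: Ic.
  exact: closed_eq.
have in_A g : supported B g -> ip g g = 1 ->
    exists2 v, A v & forall x, F v x = g x.
  move=> gB g1; exists (\row_i g (enum_val i)); last by move=> x; rewrite /F mxE enum_rankK.
  have Fg : F (\row_i g (enum_val i)) = g by apply/funext => x; rewrite /F mxE enum_rankK.
  split; last by rewrite /= Fg.
  move=> i; rewrite mxE /= in_itv /= -ler_norml /c; case: ifPn => [xB|/gB ->]; last by rewrite normr0.
  set x := enum_val i in xB *.
  have p0 := pi_gt0 x.
  have : pi x * g x * g x <= 1.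
    rewrite -g1 /inner_prod (bigD1 x)//= lerDl.
    by apply: sumr_ge0 => y _; rewrite -mulrA mulr_ge0 -?expr2 ?sqr_ge0 ?ltW.
  have -> : pi x * g x * g x = pi x * (`|g x| * `|g x|).
    by rewrite -mulrA -!expr2 real_normK// num_real.
  rewrite -ler_pdivlMl// mulr1 => h.
  have := normr_ge0 (g x); have : 0 < (pi x)^-1 by rewrite invr_gt0.
  move: h; move: (`|g x|) (pi x)^-1 => a q h q0 a0; nra.
have normalized g : 0 < ip g g -> supported B g ->
    exists2 v, A v & forall x, F v x = (Num.sqrt (ip g g))^-1 * g x.
  move=> g0 gB; apply: in_A => [x /gB ->|]; first by rewrite mulr0.
  have -> : ip (fun x => (Num.sqrt (ip g g))^-1 * g x) (fun x => (Num.sqrt (ip g g))^-1 * g x)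
      = (Num.sqrt (ip g g))^-2 * ip g g.
    by rewrite [in RHS]/inner_prod mulr_sumr; apply: eq_bigr => x _; rewrite -exprVn; ring.
  by rewrite sqr_sqrtr ?ltW// mulVf ?gt_eqF.
have A0 : (A !=set0)%classic.
  pose g x : R := (x == b)%:R.
  have g0 : 0 < ip g g by apply: (inner_gt0 _ pi_gt0 _ b); rewrite /g eqxx oner_neq0.
  have gB : supported B g by move=> x; rewrite /g; case: eqP => [->|//]; rewrite bB.
  by have [v Av _] := normalized _ g0 gB; exists v.
have [v vA vmin] := compact_EVT_min A0 A_compact (continuous_subspaceT Ec).
have [vbox v1] : A v by rewrite inE in vA.
exists (F v); rewrite v1 ltr01; split => // [x xB|g gB].
  have := vbox (enum_rank x); rewrite /= enum_rankK /c (negbTE xB) oppr0 in_itv /=.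
  by rewrite -eq_le eq_sym => /eqP.
rewrite mulr1; have [[x gx]|/forallNP g0] := pselect (exists x, g x != 0); last first.
  have -> : g = (fun=> 0) by apply/funext => x; apply/eqP; move: (g0 x) => /negP; rewrite negbK.
  by rewrite /inner_prod big1 ?mulr0 ?dirichlet_ge0// => x _; rewrite !mulr0.
have ipg := inner_gt0 _ pi_gt0 g x gx.
have [w Aw wE] := normalized _ ipg gB.
have := vmin w; rewrite inE => /(_ Aw).
have -> : E (F w) (F w) = (ip g g)^-1 * E g g.
  rewrite /dirichlet_form mulrCA; congr (_ * _); rewrite mulr_sumr; apply: eq_bigr => y _.
  rewrite mulr_sumr; apply: eq_bigr => z _; rewrite !wE.
  by rewrite -{5}(sqr_sqrtr (ltW ipg)) -exprVn; ring.
by rewrite ler_pdivlMl// mulrC.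
Qed.

(* The minimiser of the Rayleigh quotient is a critical point: testing against
   point masses shows that it is an eigenfunction of P_B. *)
Lemma rayleigh B : B != finset.set0 -> exists f,
  [/\ supported B f, 0 < ip f f, E f f = lambda P B * ip f f &
      forall g, supported B g -> lambda P B * ip g g <= E g g].
Proof.
move=> B0; have [f [fB f0 fmin]] := dirichlet_minimizer B B0.
pose l := E f f / ip f f.
have Ef : E f f = l * ip f f by rewrite /l divfK// gt_eqF.
have Eg g : supported B g -> l * ip g g <= E g g.
  by move=> gB; rewrite /l mulrAC ler_pdivrMr// fmin.
suff -> : lambda P B = l by exists f.
rewrite /lambda; suff -> : beta P B = 1 - l by ring.
have bilin g : supported B g -> E f g = l * ip f g.
  move=> gB; pose a := E f g - l * ip f g; pose q := E g g - l * ip g g.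
  have H s : 0 <= - 2 * s * a + s ^+ 2 * q.
    have : supported B (fun x => f x - s * g x).
      by move=> x xB; rewrite fB// gB// mulr0 subr0.
    move=> /Eg; rewrite dirichlet_subZ inner_subZ Ef /a /q; lra.
  have q0 : 0 <= q by rewrite subr_ge0 Eg.
  suff : a = 0 by move/eqP; rewrite subr_eq0 => /eqP.
  (* This [s] makes the quadratic equal to [- (2 + q) * s ^+ 2], which forces [a = 0]; the
     denominator is [1 + q] because [q] may vanish. *)
  have := H (a / (1 + q)).
  have -> : - 2 * (a / (1 + q)) * a + (a / (1 + q)) ^+ 2 * q = - ((2 + q) * (a / (1 + q)) ^+ 2).
    by field; lra.
  rewrite oppr_ge0 pmulr_rle0; last lra.
  move=> h; have /eqP : (a / (1 + q)) ^+ 2 = 0 by apply/le_anti; rewrite h sqr_ge0.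
  rewrite expf_eq0 /= mulf_eq0 invr_eq0 => /orP[/eqP//|/eqP]; lra.
have Pf z : z \in B -> \sum_y P z y * f y = (1 - l) * f z.
  move=> zB; pose g x : R := (x == z)%:R.
  have gB : supported B g.
    by move=> x; rewrite /g; case: eqP => [->|//]; rewrite zB.
  have dz (h : V -> R) : \sum_x h x * g x = h z.
    rewrite (bigD1 z)//= /g eqxx mulr1 big1 ?addr0// => x xz.
    by rewrite (negbTE xz) mulr0.
  have := bilin g gB; rewrite dirichletC dirichlet_green//.
  have -> : \sum_x pi x * g x * (f x - \sum_y P x y * f y) = pi z * (f z - \sum_y P z y * f y).
    rewrite -(dz (fun x => pi x * (f x - \sum_y P x y * f y))).
    by apply: eq_bigr => x _; rewrite mulrAC.
  have -> : ip f g = pi z * f z by exact: dz.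
  rewrite mulrCA => /(mulfI (lt0r_neq0 (pi_gt0 z))); lra.
have sumB g (h : V -> R) : supported B g ->
    \sum_(i < #|B|) g (enum_val i) * h (enum_val i) = \sum_x g x * h x.
  move=> gB; rewrite -(big_enum_val (A := mem B) (fun x => g x * h x)) /=.
  by rewrite big_mkcond /=; apply: eq_bigr => x _; case: ifPn => // /gB ->; rewrite mul0r.
(* [eigenvalue] is about row vectors, so by reversibility the eigenvector is [pi * f]. *)
have mem_eig : eigenvalue (restr P B) (1 - l).
  apply/eigenvalueP; exists (\row_i (pi (enum_val i) * f (enum_val i))).
    apply/rowP => j; rewrite !mxE.
    under eq_bigr => i _ do rewrite !mxE mulrAC P_rev mulrC.
    rewrite (sumB f (fun x => pi (enum_val j) * P (enum_val j) x) fB).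
    rewrite mulrCA -Pf ?enum_valP// mulr_sumr.
    by apply: eq_bigr => x _; ring.
  apply: contraTneq f0 => v0; rewrite -leNgt le_eqVlt; apply/orP; left; apply/eqP.
  rewrite /inner_prod big1// => x _; have [xB|/fB ->] := boolP (x \in B); last by rewrite mulr0.
  move/rowP: v0 => /(_ (enum_rank_in xB x)).
  by rewrite !mxE enum_rankK_in// => ->; rewrite mul0r.
have ub_eig : ubound [set a | eigenvalue (restr P B) a]%classic (1 - l).
  move=> a /eigenvalueP[v vA v0].
  (* Conversely, a row eigenvector divided by [pi] and extended by 0 is an eigenfunction [g] with
     [E g g = (1 - a) * ip g g]. The match supplies the membership proof that [enum_rank_in]
     requires. *)
  pose g x : R := if x \in B =P true is ReflectT xB then v ord0 (enum_rank_in xB x) / pi x else 0.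
  have gB : supported B g by move=> x xB; rewrite /g; case: eqP => // xB'; rewrite xB' in xB.
  have gv i : v ord0 i = pi (enum_val i) * g (enum_val i).
    rewrite /g; case: eqP => [xB|]; last by rewrite enum_valP.
    by rewrite enum_valK_in mulrC divfK// gt_eqF.
  have Pg z : z \in B -> \sum_y P z y * g y = a * g z.
    move=> zB; apply: (mulfI (lt0r_neq0 (pi_gt0 z))).
    have := congr1 (fun w : 'rV_#|B| => w ord0 (enum_rank_in zB z)) vA.
    rewrite !mxE gv enum_rankK_in// mulrCA => <-.
    under [RHS]eq_bigr => i _ do rewrite !mxE enum_rankK_in// gv mulrAC P_rev mulrC.
    rewrite (sumB g (fun x => pi z * P z x) gB) mulr_sumr.
    by apply: eq_bigr => x _; ring.
  have [x gx] : exists x, g x != 0.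
    have /rV0Pn[i vi] := v0; exists (enum_val i).
    by apply: contraNneq vi => gi; rewrite gv gi mulr0.
  have : E g g = (1 - a) * ip g g.
    rewrite dirichlet_green// /inner_prod mulr_sumr; apply: eq_bigr => y _.
    have [yB|/gB ->] := boolP (y \in B); last by rewrite !(mulr0, mul0r).
    by rewrite Pg//; ring.
  have := Eg g gB => /[swap] ->; rewrite ler_pM2r ?(inner_gt0 _ pi_gt0 _ x)//; lra.
apply/eqP; rewrite eq_le; apply/andP; split.
  by apply: ge_sup => //; exists (1 - l).
by apply: ub_le_sup => //; exists (1 - l).
Qed.
End Spectral.

(** * Irreducible sets and closed classes *)

Section Irreducibility.
Context {R : realType} {V : finType} (P : V -> V -> R) (pi : V -> R).
Hypothesis P_stoch : is_stochastic P.
Hypothesis P_rev : is_reversible P pi.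
Implicit Types (f g : V -> R) (A B D : {set V}).

(** All powers of [P_B] vanish from [A] to its complement, so a point of [B] outside [A] would be
    unreachable from [A]. *)
Lemma irreducible_closed B A : is_irreducible P B -> A \subset B ->
  A != finset.set0 ->
  (forall x y, x \in A -> y \in B -> 0 < P x y -> y \in A) -> A = B.
Proof.
move=> irr AB /finset.set0Pn[x xA] Acl; apply/eqP; rewrite finset.eqEsubset AB /=.
apply/fintype.subsetP => y yB; apply: contraT => yA.
have xB := fintype.subsetP AB x xA.
have pow0 n : forall i j, enum_val i \in A -> enum_val j \notin A -> (restr P B ^+ n) i j = 0.
  elim: n => [|n IH] i j iA jA.
    by rewrite expr0 mxE; case: eqP => // ij; rewrite -ij iA in jA.
  rewrite exprS mxE big1// => k _; have [kA|kA] := boolP (enum_val k \in A).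
    by rewrite IH ?mulr0.
  rewrite mxE; suff -> : P (enum_val i) (enum_val k) = 0 by rewrite mul0r.
  apply/eqP; apply: contraNT kA => Pik; apply: (Acl (enum_val i)) => //; first exact: enum_valP.
  by rewrite lt_def Pik (P_stoch _).1.
have := irr (enum_rank_in xB x) (enum_rank_in yB y).
rewrite eseries0 ?ltxx// => n _ _.
by rewrite pow0// enum_rankK_in.
Qed.

(** Some [i] does not reach some [j] within [B]; [A] is the set of states that [i] reaches within
    [B]. *)
Lemma reducible_split B : B != finset.set0 -> ~ is_irreducible P B ->
  exists A, [/\ A \proper B, A != finset.set0 &
    forall x y, x \in A -> y \in B :\: A -> P x y = 0].
Proof.
move=> B0 /existsNP[i /existsNP[j /negP]]; rewrite -leNgt => ij.
have pow_ge0 n : forall k k', 0 <= (restr P B ^+ n) k k'.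
  elim: n => [|n IH] k k'; first by rewrite expr0 mxE; case: eqP.
  by rewrite exprS mxE sumr_ge0// => m _; rewrite mulr_ge0// mxE (P_stoch _).1.
have ij0 n : (restr P B ^+ n) i j = 0.
  apply/eqP; rewrite eq_le pow_ge0 andbT -lee_fin; apply: le_trans ij.
  apply: le_trans (nneseries_lim_ge (P := xpredT) n.+1 _) => [|m _ _]; last by rewrite lee_fin.
  rewrite big_nat_recr//= leeDr//; apply: sume_ge0 => m _; by rewrite lee_fin.
pose A : {set V} := finset (fun x => `[< exists n k, enum_val k = x /\ 0 < (restr P B ^+ n) i k >]).
have AB : A \subset B.
  by apply/fintype.subsetP => x; rewrite inE => /asboolP[n [k [<- _]]]; exact: enum_valP.
exists A; split.
- apply/properP; split => //; exists (enum_val j); first exact: enum_valP.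
  rewrite inE; apply/asboolPn => -[n [k [/enum_val_inj ->]]].
  by rewrite ij0 ltxx.
- apply/finset.set0Pn; exists (enum_val i); rewrite inE; apply/asboolP.
  by exists 0%N, i; split => //; rewrite expr0 mxE eqxx ltr01.
- move=> x y; rewrite inE => /asboolP[n [k [<- nk]]]; rewrite inE => /andP[yA yB].
  apply/eqP; apply: contraNT yA => Pxy; rewrite inE; apply/asboolP.
  exists n.+1, (enum_rank_in yB y); rewrite enum_rankK_in//; split => //.
  rewrite exprSr mxE (bigD1 k)//= ltr_pwDl//.
    by rewrite mulr_gt0// mxE enum_rankK_in// lt_def Pxy (P_stoch _).1.
  by apply: sumr_ge0 => m _; rewrite mulr_ge0// mxE (P_stoch _).1.
Qed.

(** By reversibility the support of [pi] is closed under transitions. *)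
Lemma stationary_gt0 : is_irreducible P (finset.setT : {set V}) ->
  is_distribution pi -> forall x, 0 < pi x.
Proof.
move=> irr [pi0 pi1].
pose A : {set V} := finset (fun x => 0 < pi x).
suff AT : A = finset.setT by move=> x; have := finset.in_setT x; rewrite -AT inE.
apply: irreducible_closed => //.
  apply/finset.set0Pn; apply: contrapT => /forallNP A0.
  have : \sum_x pi x = 0.
    rewrite big1// => x _; have /negP := A0 x; rewrite inE -leNgt => h.
    by apply/le_anti; rewrite h pi0.
  by move/eqP; rewrite pi1 oner_eq0.
move=> x y; rewrite !inE => px _ Pxy.
rewrite lt_def pi0 andbT; apply: contraTneq (mulr_gt0 px Pxy) => py.
by rewrite P_rev py mul0r ltxx.
Qed.

(** Otherwise the minimiser has zero energy, hence is constant along transitions. Its zero set is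
    then closed and contains the complement of [B], so it is all of [V]. *)
Lemma lambda_gt0 B : is_irreducible P (finset.setT : {set V}) ->
  (forall x, 0 < pi x) -> B != finset.set0 ->
  B \proper (finset.setT : {set V}) -> 0 < lambda P B.
Proof.
move=> irr pi_gt0 B0 BT; have [f [fB f0 Ef _]] := rayleigh P pi P_stoch P_rev pi_gt0 B B0.
rewrite ltNge; apply/negP => l0.
have E0 : dirichlet_form P pi f f = 0.
  apply/le_anti; rewrite dirichlet_ge0// andbT Ef.
  by rewrite mulr_le0_ge0// ltW.
have fxy x y : 0 < P x y -> f x = f y.
  move=> Pxy; move/eqP: E0; rewrite mulf_eq0 invr_eq0 pnatr_eq0 /=.
  have pos (u v : V) : 0 <= pi u * P u v * ((f u - f v) * (f u - f v)).
    by rewrite mulr_ge0 ?(flow_ge0 _ _ P_stoch)// -expr2 sqr_ge0.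
  rewrite psumr_eq0 => [/allP/(_ x (mem_index_enum x))/=|u _]; last exact: sumr_ge0.
  rewrite psumr_eq0 => [/allP/(_ y (mem_index_enum y))/=|v _]; last exact: pos.
  rewrite mulf_eq0 gt_eqF ?mulr_gt0//= -expr2 sqrf_eq0 subr_eq0 => /eqP//.
pose A : {set V} := finset (fun x => f x == 0).
have AT : A = finset.setT.
  apply: irreducible_closed => //.
    have /properP[_ [x _ xB]] := BT.
    by apply/finset.set0Pn; exists x; rewrite inE fB.
  by move=> x y; rewrite !inE => /eqP fx _ /fxy <-; rewrite fx.
move: f0; rewrite /inner_prod big1 ?ltxx// => x _.
by have := finset.in_setT x; rewrite -AT inE => /eqP ->; rewrite mulr0.
Qed.

End Irreducibility.

(** * Exit times through iterates of [P] *)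

Section ExitTimes.
Context {R : realType} {V : finType} (P : V -> V -> R) (pi : V -> R).
Hypothesis P_stoch : is_stochastic P.
Implicit Types (f g : V -> R) (A B D : {set V}).

(* survival D n x is the probability that the chain started from x stays in D
   at times 0, ..., n, and green D n x the mean of min(n, T_{D^c}). *)
Fixpoint survival D n (x : V) : R :=
  (x \in D)%:R * (if n is m.+1 then \sum_y P x y * survival D m y else 1).

Definition green D n x : R := \sum_(m < n) survival D m x.

(** A limit in the reals, justified by [cvg_green] for sets that lie in one with a spectral gap. *)
Definition exit_time D x : R := limn (fun n => green D n x).

Lemma survival_ge0 D n x : 0 <= survival D n x.
Proof.
elim: n x => [|n IH] x /=; rewrite mulr_ge0 ?ler0n//.
by apply: sumr_ge0 => y _; rewrite mulr_ge0// (P_stoch _).1.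
Qed.

Lemma survival_supported D n : supported D (survival D n).
Proof. by move=> x xD; case: n => [|n] /=; rewrite (negbTE xD) mul0r. Qed.

Lemma green_supported D n : supported D (green D n).
Proof. by move=> x xD; rewrite /green big1// => m _; exact: survival_supported. Qed.

Lemma green_ge0 D n x : 0 <= green D n x.
Proof. by apply: sumr_ge0 => m _; exact: survival_ge0. Qed.

Lemma green_nondecreasing D x : nondecreasing_seq (fun n => green D n x).
Proof.
apply/nondecreasing_seqP => n.
by rewrite /green big_ord_recr lerDl survival_ge0.
Qed.

Lemma green_recl D n x : x \in D ->
  green D n.+1 x = 1 + \sum_y P x y * green D n y.
Proof.
move=> xD; rewrite /green big_ord_recl /= xD mul1r; congr (_ + _).
under eq_bigr => i _ do rewrite mul1r.
by rewrite exchange_big; apply: eq_bigr => y _; rewrite mulr_sumr.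
Qed.

Lemma exit_time_supported D : supported D (exit_time D).
Proof.
move=> x xD; rewrite /exit_time.
under eq_fun => n do rewrite (green_supported D n x xD).
exact: lim_cst.
Qed.

(** From [A] the chain can leave [A] only by leaving [D], so the survival probabilities agree at
    each time. *)
Lemma exit_time_closed A D x : A \subset D ->
  (forall x y, x \in A -> y \in D :\: A -> P x y = 0) ->
  x \in A -> exit_time D x = exit_time A x.
Proof.
move=> AD Acl xA; suff E n : green D n x = green A n x by congr (limn _); apply/funext.
apply: eq_bigr => -[m /= _] _; elim: m x xA => {n} [|n IH] x xA /=.
  by rewrite xA (fintype.subsetP AD).
rewrite xA (fintype.subsetP AD)//; congr (_ * _); apply: eq_bigr => y _.
have [/IH -> //|yA] := boolP (y \in A).
rewrite (survival_supported A)//; have [yD|yD] := boolP (y \in D).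
  by rewrite Acl ?mul0r// inE yA.
by rewrite survival_supported.
Qed.

Hypothesis P_rev : is_reversible P pi.
Hypothesis pi_gt0 : forall x, 0 < pi x.

Local Notation ip := (inner_prod pi).
Local Notation E := (dirichlet_form P pi).

(** Process-free counterpart of [mean_exit_time]; [mean_exit_timeE] identifies the two. *)
Definition mean_exit D : R := \sum_x cond_distr pi D x * exit_time D x.

Lemma weight_gt0 D : D != finset.set0 -> 0 < weight pi D.
Proof.
move=> /finset.set0Pn[x xD]; rewrite /weight (bigD1 x)//= ltr_pwDl//.
by apply: sumr_ge0 => y _; exact: ltW.
Qed.

Lemma weight_set0 : weight pi finset.set0 = 0.
Proof. by rewrite /weight big_set0. Qed.

Lemma le_weight A D : A \subset D -> weight pi A <= weight pi D.
Proof.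
move=> AD; rewrite /weight [leRHS](big_setID A)/= (finset.setIidPr AD) lerDl.
by apply: sumr_ge0 => y _; exact: ltW.
Qed.

Lemma cond_distr_distribution D : D != finset.set0 -> is_distribution (cond_distr pi D).
Proof.
move=> D0; have w0 := weight_gt0 D D0; split=> [x|].
  by rewrite mulr_ge0 ?ler0n// divr_ge0// ltW.
transitivity (weight pi D / weight pi D); last by rewrite divff// gt_eqF.
rewrite {2}/weight mulr_suml [RHS]big_mkcond; apply: eq_bigr => x _ /=.
by rewrite /cond_distr; case: (x \in D); rewrite ?mulr1 ?mulr0.
Qed.

Lemma mean_exitE D : D != finset.set0 ->
  mean_exit D * weight pi D = \sum_x pi x * exit_time D x.
Proof.
move=> D0; rewrite /mean_exit mulr_suml; apply: eq_bigr => x _.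
rewrite /cond_distr; have [xD|xD] := boolP (x \in D).
  by rewrite mulr1; field; rewrite gt_eqF// weight_gt0.
by rewrite exit_time_supported// !(mulr0, mul0r).
Qed.

(** Reversibility also forbids transitions from [D :\: A] to [A], so [mean_exit D] is the average of
    the two mean exit times, weighted by [pi], and cannot exceed both. *)
Lemma mean_exit_split A D : A \proper D -> A != finset.set0 ->
  (forall x y, x \in A -> y \in D :\: A -> P x y = 0) ->
  mean_exit D <= mean_exit A \/ mean_exit D <= mean_exit (D :\: A).
Proof.
move=> /properP[AD [z zD zA]] A0 Acl.
have C0 : D :\: A != finset.set0 by apply/finset.set0Pn; exists z; rewrite inE zA.
have D0 : D != finset.set0 by apply/finset.set0Pn; exists z.
have Ccl x y : x \in D :\: A -> y \in D :\: (D :\: A) -> P x y = 0.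
  rewrite finset.setDDr finset.setDv finset.set0U => xC /finset.setIP[_ yA].
  by apply: (mulfI (lt0r_neq0 (pi_gt0 x))); rewrite mulr0 P_rev (Acl y)// mulr0.
have eA : \sum_x pi x * exit_time A x = \sum_(x in A) pi x * exit_time D x.
  rewrite [RHS]big_mkcond; apply: eq_bigr => x _; case: ifPn => xA.
    by rewrite (exit_time_closed A D).
  by rewrite exit_time_supported// mulr0.
have eC : \sum_x pi x * exit_time (D :\: A) x = \sum_(x in D :\: A) pi x * exit_time D x.
  rewrite [RHS]big_mkcond; apply: eq_bigr => x _; case: ifPn => xA.
    by rewrite (exit_time_closed (D :\: A) D)// finset.subsetDl.
  by rewrite exit_time_supported// mulr0.
have eD : \sum_x pi x * exit_time D x = \sum_(x in D) pi x * exit_time D x.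
  rewrite [RHS]big_mkcond; apply: eq_bigr => x _; case: ifPn => // xA.
  by rewrite exit_time_supported// mulr0.
have : mean_exit D * weight pi D =
    mean_exit A * weight pi A + mean_exit (D :\: A) * weight pi (D :\: A).
  by rewrite !mean_exitE// eA eC eD (big_setID A)/= (finset.setIidPr AD).
have -> : weight pi D = weight pi A + weight pi (D :\: A).
  by rewrite /weight (big_setID A)/= (finset.setIidPr AD).
have := weight_gt0 A A0; have := weight_gt0 _ C0.
set a := weight _ A; set c := weight _ _ => c0 a0 h.
have [|hA] := leP (mean_exit D) (mean_exit A); first by left.
have [|hC] := leP (mean_exit D) (mean_exit (D :\: A)); first by right.
have := ltr_pM2r a0 (mean_exit A) (mean_exit D); rewrite hA.
have := ltr_pM2r c0 (mean_exit (D :\: A)) (mean_exit D); rewrite hC.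
lra.
Qed.

(** Induction on cardinality: while the set is reducible, pass to the better half of a splitting. *)
Lemma mean_exit_irreducible D : D != finset.set0 ->
  exists A, [/\ A != finset.set0, A \subset D, is_irreducible P A &
    mean_exit D <= mean_exit A].
Proof.
have [n] := ubnP #|D|; elim: n D => // n IH D Dn D0.
have [irr|/(reducible_split P P_stoch D D0)[A [AD A0 Acl]]] := pselect (is_irreducible P D).
  by exists D.
have AsD := proper_sub AD.
have C0 : D :\: A != finset.set0.
  by have /properP[_ [z zD zA]] := AD; apply/finset.set0Pn; exists z; rewrite inE zA.
have CD : D :\: A \proper D.
  rewrite properE finset.subsetDl /=; have /finset.set0Pn[a aA] := A0.
  apply/fintype.subsetPn; exists a; first exact: fintype.subsetP aA.
  by rewrite inE aA.
have [hA|hC] := mean_exit_split A D AD A0 Acl.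
- have [|A' [A'0 A'A irr h]] := IH A _ A0.
    by apply: leq_trans (proper_card AD) _; rewrite -ltnS.
  by exists A'; split => //; [exact: fintype.subset_trans AsD | exact: le_trans h].
- have [|A' [A'0 A'C irr h]] := IH (D :\: A) _ C0.
    by apply: leq_trans (proper_card CD) _; rewrite -ltnS.
  by exists A'; split => //; [exact: fintype.subset_trans (proper_sub CD) | exact: le_trans h].
Qed.

(** * Mean exit times under a spectral gap *)

Section Gap.
Context (B : {set V}) (l : R).
Hypothesis l_gt0 : 0 < l.
Hypothesis gap : forall g, supported B g -> l * ip g g <= E g g.

Lemma supported_sub D g : D \subset B -> supported D g -> supported B g.
Proof. by move=> DB gD x xB; apply: gD; apply: contra xB => /(fintype.subsetP DB). Qed.

(** The truncated function [G = green D n] satisfies [(I - P) G <= 1] on [D], so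
    [l * ip G G <= E G G <= s]. Working at finite [n] presupposes no convergence and yields the
    bound that proves it. *)
Lemma green_mass_le D n : D \subset B ->
  \sum_x pi x * green D n x <= weight pi D / l.
Proof.
move=> DB; set s := \sum_x _.
have GB := supported_sub D _ DB (green_supported D n).
have Es : E (green D n) (green D n) <= s.
  rewrite dirichlet_green//; apply: ler_sum => x _.
  have [xD|xD] := boolP (x \in D); last by rewrite green_supported// !(mulr0, mul0r).
  rewrite -[leRHS]mulr1 ler_wpM2l//; first by rewrite mulr_ge0 ?green_ge0// ltW.
  have := green_recl D n x xD; rewrite {1}/green big_ord_recr /= -/(green D n x).
  have := survival_ge0 D n x; lra.
have Gs : l * ip (green D n) (green D n) <= s by exact: le_trans (gap _ GB) Es.
(* Cauchy-Schwarz in additive form: the square of [1_D / l - G] has nonnegative sum. *)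
have sq : 2 * s / l <= weight pi D / l ^+ 2 + ip (green D n) (green D n).
  rewrite -subr_ge0.
  have -> : weight pi D / l ^+ 2 + ip (green D n) (green D n) - 2 * s / l =
      \sum_x pi x * ((x \in D)%:R / l - green D n x) ^+ 2.
    rewrite /s /weight /inner_prod big_mkcond -mulrA !mulr_suml mulr_sumr.
    rewrite -big_split -sumrB; apply: eq_bigr => x _ /=.
    have [xD|xD] := boolP (x \in D); first by rewrite mul1r; field; rewrite gt_eqF.
    by rewrite (green_supported D n x xD) /= mulr0n; ring.
  by apply: sumr_ge0 => x _; rewrite mulr_ge0 ?sqr_ge0// ltW.
rewrite ler_pdivlMr//.
have : ip (green D n) (green D n) <= s / l by rewrite ler_pdivlMr// mulrC.
move=> h; have {sq h} : 2 * s / l <= weight pi D / l ^+ 2 + s / l by lra.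
rewrite -(ler_pM2r (x := l ^+ 2)) ?exprn_gt0//.
have -> : 2 * s / l * l ^+ 2 = 2 * (s * l) by field; rewrite gt_eqF.
have -> : (weight pi D / l ^+ 2 + s / l) * l ^+ 2 = weight pi D + s * l by field; rewrite gt_eqF.
lra.
Qed.

Lemma cvg_green D x : D \subset B -> (green D n x @[n --> \oo] --> exit_time D x)%classic.
Proof.
move=> DB; apply: nondecreasing_is_cvgn; first exact: green_nondecreasing.
exists (weight pi D / l / pi x) => _ [n _ <-].
rewrite ler_pdivlMr// mulrC; apply: le_trans (green_mass_le D n DB).
rewrite (bigD1 x)//= lerDl; apply: sumr_ge0 => y _.
by rewrite mulr_ge0 ?green_ge0// ltW.
Qed.

Lemma cvg_weighted_green (h : V -> R) D : D \subset B ->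
  ((\sum_x h x * green D n x) @[n --> \oo] --> \sum_x h x * exit_time D x)%classic.
Proof.
move=> DB; apply: cvg_big => [|x _]; first exact: add_continuous.
by apply: cvgMl_tmp; exact: cvg_green.
Qed.

Lemma green_le_exit_time D n x : D \subset B -> green D n x <= exit_time D x.
Proof.
move=> DB; apply: nondecreasing_cvgn_le; first exact: green_nondecreasing.
by apply/cvg_ex; exists (exit_time D x); exact: cvg_green.
Qed.

Lemma exit_time_eq D x : D \subset B -> x \in D ->
  exit_time D x = 1 + \sum_y P x y * exit_time D y.
Proof.
move=> DB xD.
have h1 : (green D n.+1 x @[n --> \oo] --> exit_time D x)%classic.
  have := cvg_green D x DB; rewrite -(cvg_shiftS (fun n => green D n x)); exact.
have h2 : (green D n.+1 x @[n --> \oo] --> 1 + \sum_y P x y * exit_time D y)%classic.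
  under eq_fun => n do rewrite green_recl//.
  by apply: cvgD; [exact: cvg_cst | exact: cvg_weighted_green].
exact: cvg_unique h1 h2.
Qed.

Lemma mean_exit_le D : D != finset.set0 -> D \subset B -> mean_exit D <= 1 / l.
Proof.
move=> D0 DB; rewrite -(ler_pM2r (weight_gt0 D D0)) mean_exitE// mul1r mulrC.
have cv := cvg_weighted_green pi D DB.
rewrite -(cvg_lim (@Rhausdorff R) cv).
apply: limr_le; first by apply/cvg_ex; eexists; exact: cv.
by apply: nearW => n; exact: green_mass_le.
Qed.

Lemma mean_exit_gt0 D : D != finset.set0 -> D \subset B -> 0 < mean_exit D.
Proof.
move=> D0 DB; rewrite -(pmulr_lgt0 _ (weight_gt0 D D0)) mean_exitE//.
have /finset.set0Pn[x xD] := D0.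
have h y : green D 1 y <= exit_time D y by exact: green_le_exit_time.
have : 0 < green D 1 x by rewrite /green big_ord1 /= xD mul1r.
move=> /lt_le_trans /(_ (h x)) ex.
rewrite (bigD1 x)//= ltr_pwDl ?mulr_gt0//; apply: sumr_ge0 => y _.
apply: mulr_ge0; first exact: ltW.
exact: le_trans (green_ge0 D 1 y) (h y).
Qed.

(* exit_time D solves (I - P) u = 1 on D, hence E(g, u) = <g, 1>. *)
Lemma torsion D g s : D \subset B -> supported D g ->
  2 * s * (\sum_x pi x * g x) <= E g g + s ^+ 2 * \sum_x pi x * exit_time D x.
Proof.
move=> DB gD.
have Eu h : supported D h -> E h (exit_time D) = \sum_x pi x * h x.
  move=> hD; rewrite dirichlet_green//; apply: eq_bigr => x _.
  have [xD|/hD ->] := boolP (x \in D); last by rewrite !(mulr0, mul0r).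
  by rewrite {1}(exit_time_eq D x DB xD) addrK mulr1.
(* Expanding this energy with [Eu] for both [g] and [exit_time D] is the claim; keeping [s] free
   replaces the discriminant form of Cauchy-Schwarz. *)
have := dirichlet_ge0 P pi P_stoch pi_gt0 (fun x => g x - s * exit_time D x).
rewrite dirichlet_subZ !Eu//; last exact: exit_time_supported.
lra.
Qed.

End Gap.

(** With [K] the maximal mean exit time over nonempty subsets of [B], [torsion] provides the
    hypothesis of [level_sets_energy]. *)
Lemma mean_exit_ge B : is_distribution pi -> B != finset.set0 -> 0 < lambda P B ->
  exists D, [/\ D != finset.set0, D \subset B & 48^-1 / lambda P B <= mean_exit D].
Proof.
move=> [_ pi1] B0 l0; have [f [fB f0 Ef gap]] := rayleigh P pi P_stoch P_rev pi_gt0 B B0.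
have B_ok : (B != finset.set0) && (B \subset B) by rewrite B0 /=.
pose D := [arg max_(D > B | (D != finset.set0) && (D \subset B)) mean_exit D]%O.
have [D0 DB Dmax] : [/\ D != finset.set0, D \subset B &
    forall D', D' != finset.set0 -> D' \subset B -> mean_exit D' <= mean_exit D].
  rewrite /D; case: Order.TotalTheory.arg_maxP => // D1 /andP[D10 D1B] D1max; split=> // D' h1 h2.
  by apply: D1max; rewrite h1.
exists D; split => //.
have K0 := mean_exit_gt0 B _ l0 gap D D0 DB.
(* The level-set argument requires a nonnegative function; taking absolute values keeps the norm and
   does not raise the energy. *)
pose g x := `|f x|.
have gB : supported B g by move=> x /fB; rewrite /g => ->; rewrite normr0.
have ipg : ip g g = ip f f.
  by apply: eq_bigr => x _; rewrite -!mulrA -!expr2 real_normK// num_real.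
have Eg : E g g <= E f f.
  by apply: dirichlet_contract => // x y; exact: ler_dist_dist.
have g0 x : 0 <= g x by exact: normr_ge0.
have := level_sets_energy P pi P_stoch pi_gt0 B (mean_exit D) g K0 pi1 g0 gB.
have H D' h s : D' \subset B -> supported D' h ->
    2 * s * (\sum_x pi x * h x) <= E h h + s ^+ 2 * (mean_exit D * weight pi D').
  move=> D'B hD'; apply: le_trans (torsion B _ l0 gap D' h s D'B hD') _.
  rewrite lerD2l ler_wpM2l ?sqr_ge0//.
  (* A level set may be empty, where maximality says nothing; there the exit time and the weight
     both vanish. *)
  have [->|D'0] := eqVneq D' finset.set0.
    rewrite weight_set0 mulr0 big1// => x _.
    by rewrite exit_time_supported ?inE// mulr0.
  by rewrite -mean_exitE// ler_wpM2r ?Dmax// ltW// weight_gt0.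
move=> /(_ H); rewrite ipg => h.
have {h} : ip f f <= 48 * mean_exit D * (lambda P B * ip f f).
  by rewrite -Ef (le_trans h)// ler_wpM2l// mulr_ge0// ltW.
rewrite -{1}[ip f f]mul1r mulrA ler_pM2r// => h.
rewrite ler_pdivrMr//; lra.
Qed.

End ExitTimes.

(** * From the process to the iterates of [P] *)

Section MarkovChain.
Context {R : realType} {V : finType} {d : measure_display} {Omega : measurableType d}.
Context (P : V -> V -> R) (mu : V -> R) (Q : probability Omega R) (X : nat -> Omega -> V).
Hypothesis P_stoch : is_stochastic P.
Hypothesis chain : is_markov_chain P mu Q X.
Implicit Types (D : {set V}).

Local Open Scope classical_set_scope.

Definition stays D n m : set Omega :=
  [set w | forall i, (i <= m)%N -> X (n + i)%N w \in D].

Lemma measurable_state n (S : set V) : measurable (X n @^-1` S).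
Proof.
have [mX _ _] := chain.
have -> : X n @^-1` S = \bigcup_(z in S) X n @^-1` [set z].
  by apply/seteqP; split=> [w Sw|w [z Sz /= ->//]]; exists (X n w).
by apply: fin_bigcup_measurable => // z _; exact: mX.
Qed.

Lemma measurable_stays D n m : measurable (stays D n m).
Proof.
have -> : stays D n m = \bigcap_(i in [set i | (i <= m)%N]) X (n + i)%N @^-1` [set` D] by [].
by apply: bigcap_measurableType => i _; exact: measurable_state.
Qed.

Lemma measurable_history n x : measurable (history X n x).
Proof.
have -> : history X n x = \bigcap_(i in [set i | (i <= n)%N]) X i @^-1` [set x i] by [].
by apply: bigcap_measurableType => i _; exact: measurable_state.
Qed.

Lemma total_probability n (A : set Omega) : measurable A ->
  Q A = (\sum_(z : V) Q (A `&` X n @^-1` [set z]))%E.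
Proof.
move=> mA; rewrite fsbig_seq ?index_enum_uniq// -measure_fin_bigcup//=.
- congr (Q _); apply/seteqP; split=> [w Aw|w [z _ []//]].
  by exists (X n w) => //=; rewrite mem_index_enum.
- by move=> z z' _ _ [w [[_ /= <-] [_ /= <-]]].
- by move=> z _; apply: measurableI => //; exact: measurable_state.
Qed.

Lemma stays_notin D n m (A : set Omega) z : A `<=` X n @^-1` [set z] ->
  z \notin D -> A `&` stays D n m = set0.
Proof.
move=> AX zD; apply/seteqP; split=> // w [/AX /= Xz /(_ 0%N (leq0n m))].
by rewrite addn0 Xz (negbTE zD).
Qed.

(** Induction on [m] with [n] and the path general: split according to the state at time [n + 1],
    absorb it into the history, and apply the Markov property. *)
Lemma history_stays D m n x : Q (history X n x `&` stays D n m) =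
  (Q (history X n x) * (survival P D m (x n))%:E)%E.
Proof.
have [_ _ markov] := chain.
have hX n' x' : history X n' x' `<=` X n' @^-1` [set x' n'] by move=> w; exact.
elim: m n x => [|m IH] n x; have [xD|xD] := boolP (x n \in D);
  try by rewrite (stays_notin _ _ _ _ _ (hX n x) xD) measure0 survival_supported// mule0.
  rewrite /= xD mulr1 mule1; congr (Q _); apply/seteqP; split=> [w []//|w hw]; split=> // i.
  by rewrite leqn0 => /eqP ->; rewrite addn0 hw.
(* The history up to [n.+1] only reads the path up to that index, so changing one value prescribes
   the next state. *)
pose ext z i := if i == n.+1 then z else x i.
have ext_n z : ext z n = x n by rewrite /ext ltn_eqF.
have ext_history z : history X n (ext z) = history X n x.
  by apply/seteqP; split=> w hw i i_n; rewrite hw// /ext ltn_eqF// ltnS.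
rewrite (total_probability n.+1); last first.
  by apply: measurableI; [exact: measurable_history | exact: measurable_stays].
have step z : history X n x `&` stays D n m.+1 `&` X n.+1 @^-1` [set z] =
    history X n.+1 (ext z) `&` stays D n.+1 m.
  apply/seteqP; split=> w.
    move=> [[hw sw] /= zw]; split=> [i|i im].
      rewrite leq_eqVlt ltnS => /orP[/eqP ->|i_n]; first by rewrite /ext eqxx.
      by rewrite hw// /ext ltn_eqF// ltnS.
    by rewrite addSnnS; exact: sw.
  move=> [hw sw]; split; last by rewrite /= hw// /ext eqxx.
  have hxw : history X n x w.
    by move=> i i_n; rewrite hw ?(leqW i_n)// /ext ltn_eqF// ltnS.
  split=> // -[|i] im; first by rewrite addn0 hxw.
  by rewrite -addSnnS; exact: sw.
transitivity (\sum_(z : V) Q (history X n x) * (P (x n) z * survival P D m z)%:E)%E.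
  apply: eq_bigr => z _; rewrite step IH markov ext_history ext_n.
  by rewrite /ext eqxx EFinM muleA.
rewrite /= xD mul1r -sumEFin ge0_sume_distrr// => z _.
by rewrite lee_fin mulr_ge0 ?survival_ge0// (P_stoch _).1.
Qed.

Lemma stays_probability D m :
  Q (stays D 0 m) = (\sum_z mu z * survival P D m z)%:E.
Proof.
have [_ init _] := chain.
rewrite (total_probability 0%N _ (measurable_stays D 0 m)) -sumEFin; apply: eq_bigr => z _.
have hz : history X 0 (fun=> z) = X 0%N @^-1` [set z].
  by apply/seteqP; split=> w; [exact | move=> /= wz i; rewrite leqn0 => /eqP ->].
by rewrite setIC -hz history_stays hz init EFinM.
Qed.

(** The tail formula: [stays D 0 m] is the event that the exit time exceeds [m]. *)
Lemma hitting_time_series D w :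
  hitting_time (R := R) X (~: D) w = (\sum_(0 <= m <oo) (\1_(stays D 0 m) w)%:E)%E.
Proof.
have ind0 m : (0 <= m)%N -> ((0 : \bar R) <= (\1_(stays D 0 m) w)%:E)%E by rewrite lee_fin.
(* Without an exit, the infimum of the empty set is [+oo] and all terms of the series are 1. *)
have [[m0 Xm0]|never] := pselect (exists m, X m w \notin D); last first.
  have stay m : stays D 0 m w.
    by move=> i _; apply: contrapT => /negP Xi; apply: never; exists i.
  transitivity (+oo%E : \bar R).
    rewrite /hitting_time (_ : [set _ | _ in _] = set0) ?ereal_inf0//.
    apply/seteqP; split=> // _ [m /= + _]; rewrite inE => Xm.
    by apply: never; exists m.
  apply/esym/eq_infty => r; apply: le_trans (nneseries_lim_ge (Num.truncn r).+1 _); last first.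
    by move=> m _ _; exact: ind0.
  under eq_bigr => m _ do rewrite indicE mem_set//.
  rewrite sumEFin lee_fin big_const_nat subn0 iter_addr_0.
  exact: ltW (truncnS_gt r).
have ex : exists m, X m w \notin D by exists m0.
case: (ex_minnP ex) => {Xm0 ex} m Xm mmin {m0}.
have stayE k : (\1_(stays D 0 k) w = (k < m)%N%:R :> R).
  rewrite indicE; congr ((nat_of_bool _)%:R); apply/idP/idP.
    rewrite inE => sk; rewrite ltnNge; apply: contra Xm => mk; exact: sk.
  move=> km; rewrite inE => i ik; apply: contraT => /mmin; rewrite leqNgt.
  by rewrite add0n (leq_ltn_trans ik km).
rewrite (nneseries_split 0 m); last by move=> k _; exact: ind0.
rewrite eseries0 ?adde0; last first.
  by move=> k; rewrite add0n => mk _; rewrite stayE ltnNge mk.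
rewrite add0n sumEFin; have -> : \sum_(0 <= k < m) (\1_(stays D 0 k) w : R) = m%:R.
  rewrite (eq_big_nat _ _ (F2 := fun=> 1)) => [|k /andP[_ km]]; last by rewrite stayE km.
  by rewrite big_const_nat subn0 iter_addr_0.
apply/le_anti/andP; split.
  by apply: ereal_inf_lbound; exists m => //=; rewrite inE.
apply: le_ereal_inf_tmp => _ [k /= + <-]; rewrite inE => /mmin.
by rewrite lee_fin ler_nat.
Qed.

End MarkovChain.

(** Integrating the tail series term by term gives limits of averaged [green]; the gap makes this
    limit finite. *)
Lemma mean_exit_timeE {R : realType} {V : finType} (P : V -> V -> R) (pi : V -> R)
    {d : measure_display} {Omega : measurableType d}
    (Pr : (V -> R) -> probability Omega R) (X : nat -> Omega -> V) (l : R) (B D : {set V}) :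
  is_stochastic P -> is_reversible P pi -> (forall x, 0 < pi x) ->
  is_markov_family P Pr X -> 0 < l ->
  (forall g, supported B g -> l * inner_prod pi g g <= dirichlet_form P pi g g) ->
  D != finset.set0 -> D \subset B ->
  mean_exit_time Pr X pi D = (mean_exit P pi D)%:E.
Proof.
move=> P_stoch P_rev pi_gt0 family l0 gap D0 DB.
have chain := family _ (cond_distr_distribution pi pi_gt0 D D0).
rewrite /mean_exit_time; set Q := Pr _ in chain *.
have mS m := measurable_stays _ _ _ _ chain D 0 m.
under eq_integral => w _ do rewrite hitting_time_series.
rewrite integral_nneseries//; last first.
  by move=> m; apply/measurable_EFinP; exact: measurable_indic.
transitivity (limn (EFin \o (fun n => \sum_z cond_distr pi D z * green P D n z))).
  congr (limn _); apply/funext => n /=.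
  transitivity (\sum_(0 <= m < n) (\sum_z cond_distr pi D z * survival P D m z)%:E)%E.
    apply: eq_bigr => m _; rewrite integral_indic// setIT.
    exact: (stays_probability _ _ _ _ P_stoch chain).
  rewrite sumEFin exchange_big; congr (_%:E).
  by apply: eq_bigr => z _; rewrite -mulr_sumr big_mkord.
have cv := cvg_weighted_green P pi P_stoch P_rev pi_gt0 B l l0 gap (cond_distr pi D) D DB.
rewrite EFin_lim; last by apply/cvg_ex; eexists; exact: cv.
by rewrite (cvg_lim _ cv).
Qed.

(** * Comparison of [lambda], mean exit times and [kappa] *)

Lemma pi_min_gt0 {R : realType} {V : finType} (pi : V -> R) :
  (forall x, 0 < pi x) -> 0 < pi_min pi.
Proof. by move=> pi_gt0; rewrite /pi_min; apply/bigmin_gtP; split. Qed.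

Lemma weight_lt1_proper {R : realType} {V : finType} (pi : V -> R) (B : {set V}) :
  is_distribution pi -> 0 < weight pi B < 1 ->
  B != finset.set0 /\ B \proper (finset.setT : {set V}).
Proof.
move=> [_ pi1] /andP[B0 B1]; split.
  by apply: contraTneq B0 => ->; rewrite weight_set0 ltxx.
rewrite finset.properT; apply: contraTneq B1 => ->.
rewrite -leNgt /weight -pi1 le_eqVlt; apply/orP; left; apply/eqP.
by apply: eq_bigl => x; rewrite finset.in_setT.
Qed.

Theorem theorem1p2 (R : realType) :
  exists c2 : R, 0 < c2 /\
  forall (V : finType) (P : V -> V -> R) (pi : V -> R)
    (d : measure_display) (Omega : measurableType d)
    (Pr : (V -> R) -> probability Omega R) (X : nat -> Omega -> V),
    (1 < #|V|)%N ->
    is_stochastic P -> is_irreducible P (finset.setT : {set V}) ->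
    is_distribution pi -> is_reversible P pi ->
    is_markov_family P Pr X ->
    (forall B : {set V}, B != finset.set0 -> B \proper (finset.setT : {set V}) ->
      ((c2 / lambda P B)%:E <=
         \big[maxe/-oo]_(D : {set V} | (D != finset.set0) && (D \subset B))
           mean_exit_time Pr X pi D <=
         (1 / lambda P B)%:E)%E) /\
    (forall delta : R, pi_min pi <= delta <= 1 ->
      (spectral_profile P pi delta <= kappa P Pr X pi delta <=
         (1 / c2)%:E * spectral_profile P pi delta)%E).
Proof.
(* The constant 48 comes from [level_sets_energy]. *)
exists 48^-1; split; first by rewrite invr_gt0.
move=> V P pi d Omega Pr X _ P_stoch irr pi_distr P_rev family.
have pi_gt0 := stationary_gt0 P pi P_stoch P_rev irr pi_distr.
have lam_gt0 B := lambda_gt0 P pi P_stoch P_rev B irr pi_gt0.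
have gap B (B0 : B != finset.set0) g : supported B g ->
    lambda P B * inner_prod pi g g <= dirichlet_form P pi g g.
  by have [f [_ _ _]] := rayleigh P pi P_stoch P_rev pi_gt0 B B0; exact.
have mean_le B D (B0 : B != finset.set0) (BT : B \proper finset.setT)
    (D0 : D != finset.set0) (DB : D \subset B) :
    mean_exit_time Pr X pi D = (mean_exit P pi D)%:E /\
    0 < mean_exit P pi D <= 1 / lambda P B.
  have l0 := lam_gt0 B B0 BT.
  split; first exact: mean_exit_timeE P_stoch P_rev pi_gt0 family l0 (gap B B0) D0 DB.
  rewrite (mean_exit_gt0 _ _ P_stoch P_rev pi_gt0 _ _ l0 (gap B B0) _ D0 DB) /=.
  exact: (mean_exit_le _ _ P_stoch P_rev pi_gt0 _ _ l0 (gap B B0) _ D0 DB).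
split=> [B B0 BT|delta _].
  have l0 := lam_gt0 B B0 BT; apply/andP; split.
    have [D [D0 DB h]] := mean_exit_ge P pi P_stoch P_rev pi_gt0 B pi_distr B0 l0.
    apply: (@bigmax_sup _ _ _ _ D); first by rewrite D0.
    by have [-> _] := mean_le B D B0 BT D0 DB; rewrite lee_fin.
  apply: bigmax_le => [|D /andP[D0 DB]]; first by rewrite leNye.
  by have [-> /andP[_ h]] := mean_le B D B0 BT D0 DB; rewrite lee_fin.
have small B : 0 < weight pi B <= Num.min delta (1 - pi_min pi) ->
    B != finset.set0 /\ B \proper (finset.setT : {set V}).
  move=> /andP[h0 h1]; apply: weight_lt1_proper pi_distr _; rewrite h0.
  apply: le_lt_trans h1 _; rewrite gt_min; apply/orP; right.
  by rewrite ltrBlDr ltrDl pi_min_gt0.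
apply/andP; split.
  (* Each [B] competing in [kappa] also competes in the profile, and [mean_le] with [D = B] compares
     the two values. *)
  apply: le_bigmin => [|B /andP[Bs _]]; first by rewrite leey.
  have [B0 BT] := small B Bs; apply: (@bigmin_inf _ _ _ _ B) => //.
  have [-> /andP[m0 m1]] := mean_le B B B0 BT B0 (fintype.subxx B).
  rewrite inver gt_eqF// lee_fin -[lambda P B]invrK lef_pV2 ?posrE ?invr_gt0//.
  - by rewrite -div1r.
  - exact: lam_gt0.
rewrite invrK mul1r.
(* For an empty family the profile takes its default [+oo] and the bound is trivial. *)
have [Bs|none] := pselect (exists B, 0 < weight pi B <= Num.min delta (1 - pi_min pi)); last first.
  rewrite /spectral_profile big_pred0.
    by rewrite gt0_muley ?leey// lte_fin.
  by move=> B; apply/negP => h; apply: none; exists B.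
have [B Bw ->] : exists2 B, 0 < weight pi B <= Num.min delta (1 - pi_min pi) &
    spectral_profile P pi delta = (lambda P B)%:E.
  have [B0 B0w] := Bs.
  have [|B Bw BE] := @eq_bigmin _ _ _ (+oo%E : \bar R) B0
      (fun B : {set V} => 0 < weight pi B <= Num.min delta (1 - pi_min pi))
      (fun B => (lambda P B)%:E) B0w; first by move=> B _; rewrite leey.
  by exists B.
have [B0 BT] := small B Bw; have l0 := lam_gt0 B B0 BT.
(* From the minimiser [B] pass to a subset [D] with long exit time, then to an irreducible [A]
   inside [D]; weights only decrease, so [A] competes in [kappa]. *)
have [D [D0 DB hD]] := mean_exit_ge P pi P_stoch P_rev pi_gt0 B pi_distr B0 l0.
have [A [A0 AD irrA hA]] :=
  mean_exit_irreducible P pi P_stoch P_rev pi_gt0 D D0.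
have AB : A \subset B by exact: fintype.subset_trans DB.
apply: (@bigmin_inf _ _ _ _ A).
  apply/andP; split; last exact/asboolP.
  rewrite weight_gt0//= (le_trans (le_weight pi pi_gt0 _ _ AB))//.
  by case/andP: Bw.
have [-> /andP[m0 _]] := mean_le B A B0 BT A0 AB.
rewrite inver gt_eqF// -EFinM lee_fin -[leRHS]invrK lef_pV2 ?posrE ?invr_gt0 ?mulr_gt0//.
by rewrite invfM; exact: le_trans hD hA.
Qed.
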